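(* Let $f\in H_1(ST^*\mathbb{R}^2)$ be the class of a positively oriented fiber. Let $L$ be a generic oriented cooriented wave front on $\mathbb{R}^2$, $\lambda$ the corresponding Legendrian curve, and $f^h$ the homology class realized by $\lambda$. Let $l_q(\lambda)-[h]_qh=\sum_{m\in\mathbb{Z}}n_m[m]_q$ be the unique such expression with all $n_m$ non-negative half-integers (elements of $\frac12\mathbb{Z}_{\ge0}$, finitely many non-zero), $n_0=0$, and $n_{-m}=0$ whenever $n_m>0$. Write $S(\lambda)=\sum_{l\in\mathbb{Z}}k_lf^l$ with $k_l\in\frac12\mathbb{Z}$. Then $$l_q(\lambda)=[h]_qh+\sum_{k_l>0}k_l[2l-h-1]_q$$ and $$S(\lambda)=\sum_{n_m>0}n_m\bigl(f^{\frac{h+1+m}{2}}-f^{\frac{h+1-m}{2}}\bigr).$$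
   Context: $\mathbb{R}^2$ has its standard orientation. $ST^*\mathbb{R}^2$ is the space of cooriented contact elements of $\mathbb{R}^2$, an $S^1$-fibration over $\mathbb{R}^2$ with fibers oriented counterclockwise; $H_1(ST^*\mathbb{R}^2)$ is infinite cyclic generated by $f$, written multiplicatively, with unit $e$. A Legendrian curve is an immersed circle tangent to the natural contact structure; its cooriented projection is its wave front, from which it is recovered by the coorienting normals. A front is generic if it is an immersion except at finitely many cusps, and all multiple points are transversal double points. $\mathrm{ind}(L)$ is the degree of the map $S^1\to S^1$ given by the coorienting normal direction (so $[\lambda]=f^{\mathrm{ind}(L)}$). Quantum numbers: $[n]_q=\frac{q^n-q^{-n}}{q-q^{-1}}$, $n\in\mathbb{Z}$. A branch of $L$ is positive (negative) if the frame (coorienting vector, orienting vector) is positively (negatively) oriented; for a double point $v$, $\epsilon(v)=+1$ if the signs of the two branches coincide and $-1$ otherwise. A cusp is positive (negative) if the coorienting vector turns in the positive (negative) direction while traversing a neighborhood of the cusp along the orientation; $C^{\pm}$ is half the number of positive/negative cusps. At a double point $v$ of $L$ the fiber over $v$ divides $\lambda$ into two oriented arcs; rotating the plane so that both branches at $v$ are directed upwards, the two pieces of the oriented smoothing of $L$ at $v$ lie to the left and to the right of $v$. (1) $\mathrm{ind}(L^+_v)$ (respectively $\mathrm{ind}(L^-_v)$) is the index of the front $L^+_v$ lying to the left (respectively $L^-_v$ lying to the right) obtained by splitting $L$ at $v$ with respect to orientation and coorientation; it is the exponent of $f$ in the class of the closed curve obtained from the left (respectively right) arc of $\lambda$ by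 joining its end point to its starting point along the shorter arc (angle less than $\pi$) of the fiber over $v$. (2) $[\tilde\lambda^+_v]$ (respectively $[\tilde\lambda^-_v]$) is the class of the closed curve obtained from the left (respectively right) arc of $\lambda$ by adding the arc of the fiber which, with the positive (counterclockwise) orientation, runs from its end point to its starting point. The invariants: $$l_q(\lambda)=\sum_v[\mathrm{ind}(L^+_v)-\mathrm{ind}(L^-_v)-\epsilon(v)]_q+[1-\mathrm{ind}(L)]_qC^++[\mathrm{ind}(L)+1]_qC^-+[\mathrm{ind}(L)]_q\,\mathrm{ind}(L)\in\tfrac12\mathbb{Z}[q,q^{-1}],$$ $$S(\lambda)=\sum_v\Bigl([\tilde\lambda^+_v]-[\tilde\lambda^-_v]\Bigr)+(f-[\lambda])C^++([\lambda]f-e)C^-\in\tfrac12\mathbb{Z}[H_1(ST^*\mathbb{R}^2)],$$ sums over all double points $v$ of $L$; $\frac12\mathbb{Z}[G]$ denotes formal half-integer linear combinations of elements of $G$. *)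

(* Defs.v *)
From HB Require Import structures.
From mathcomp Require Import all_boot all_order all_algebra finmap.
From mathcomp Require Import all_classical all_reals all_analysis.
From mathcomp Require Import freeg.

Set Implicit Arguments.
Unset Strict Implicit.
Unset Printing Implicit Defensive.

Import Order.TTheory GRing.Theory Num.Theory.
Import numFieldNormedType.Exports.

Local Open Scope classical_set_scope.
Local Open Scope ring_scope.

Section Plane.
Variable R : realType.
Implicit Types (p : R -> R * R) (u v : R * R) (t a : R).

Definition dot u v : R := u.1 * v.1 + u.2 * v.2.

Definition det2 u v : R := u.1 * v.2 - u.2 * v.1.

Definition unit_vec a : R * R := (cos a, sin a).

Definition rot a u : R * R :=
  (cos a * u.1 - sin a * u.2, sin a * u.1 + cos a * u.2).

Definition smooth p : Prop := forall (k : nat) t,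
  derivable (derive1n k (fun x => (p x).1)) t 1 /\
  derivable (derive1n k (fun x => (p x).2)) t 1.

Definition der (k : nat) p t : R * R :=
  (derive1n k (fun x => (p x).1) t, derive1n k (fun x => (p x).2) t).

(* A closed curve on the unit circle is a map defined on [0, 1]; its degree is
   read off from a continuous determination of the angle.  The default value of
   [xget] is only reached when there is no such determination. *)
Definition angle_lift p (theta : R -> R) : Prop :=
  {within `[0, 1], continuous theta} /\
  (forall x, x \in `[0, 1] -> p x = unit_vec (theta x)).

Definition degree p : int :=
  xget 0 [set k : int | exists2 theta, angle_lift p theta &
                          theta 1 - theta 0 = 2 * pi * k%:~R].

End Plane.

(* A cooriented contact element of the plane is a point together with the unit
   normal vector coorienting the contact line through it; the fiber is
   the circle of these normals.  An oriented Legendrian curve is a 1-periodic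
   map, oriented by increasing parameter, and its front is its first component. *)
Record legendrian (R : realType) := Legendrian {
  front : R -> R * R;
  normal : R -> R * R;
  front_smooth : smooth front;
  normal_smooth : smooth normal;
  front_periodic : forall t, front (t + 1) = front t;
  normal_periodic : forall t, normal (t + 1) = normal t;
  normal_unit : forall t, dot (normal t) (normal t) = 1;
  contact : forall t, dot (normal t) (der 1 front t) = 0;
  immersed : forall t, (der 1 front t, der 1 normal t) != ((0, 0), (0, 0))
}.

Section Fronts.
Variable R : realType.
Implicit Types (L : legendrian R) (s t : R) (v : R * R).

(* H_1 of the space R^2 x S^1 of cooriented contact elements is the infinite
   cyclic group generated by the class f of the counterclockwise fiber; the
   class of a closed curve is represented by its exponent of f, which is the
   degree of its S^1-component since R^2 is contractible. *)
Definition homology_class (gamma : R -> (R * R) * (R * R)) : int :=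
  degree (fun x => (gamma x).2).

Definition lambda L t : (R * R) * (R * R) := (front L t, normal L t).

Definition ind L : int := degree (normal L).

Definition circle : set R := `[0, 1[.

Definition velocity L t : R * R := der 1 (front L) t.

Definition cusps L : set R := [set t | circle t /\ velocity L t = (0, 0)].

Definition semicubical L t : Prop :=
  det2 (der 2 (front L) t) (der 3 (front L) t) != 0.

Definition generic L : Prop :=
  [/\ finite_set (cusps L),
      forall t, cusps L t -> semicubical L t,
      forall r s t, circle r -> circle s -> circle t ->
        front L r = front L s -> front L s = front L t ->
        [\/ r = s, s = t | r = t]
    & forall s t, circle s -> circle t -> s != t -> front L s = front L t ->
        det2 (velocity L s) (velocity L t) != 0].

(* A double point is recorded once, by its two parameters (s, t) ordered so that
   the direction at s is obtained from the direction at t by a counterclockwise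
   rotation of angle less than pi.  When both branches are directed upwards, the
   piece of the smoothing that leaves along s and comes back along t is then the
   one on the left. *)
Definition double_points L : set (R * R) :=
  [set v | [/\ circle v.1, circle v.2, front L v.1 = front L v.2
             & 0 < det2 (velocity L v.2) (velocity L v.1)]].

Definition positive_branch L t : bool := 0 < det2 (normal L t) (velocity L t).

Definition eps L v : int :=
  if positive_branch L v.1 == positive_branch L v.2 then 1 else -1.

(* Parameter of the end of the arc of the circle R/Z running from s to t. *)
Definition arc_end s t : R := if s < t then t else t + 1.

(* The arc of lambda from s to t followed by the arc of the fiber over its end
   point along which the normal turns by the angle a. *)
Definition close_up L s t (a : R) (x : R) : (R * R) * (R * R) :=
  if x <= 2^-1 then lambda L (s + 2 * x * (arc_end s t - s))
  else (front L t, rot ((2 * x - 1) * a) (normal L t)).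

(* Angles of the two fiber arcs joining the end of the arc from s to t to its
   start; both exist and are unique at a transversal double point. *)
Definition short_angle L s t : R :=
  xget 0 [set a | - pi < a < pi /\ rot a (normal L t) = normal L s].

Definition positive_angle L s t : R :=
  xget 0 [set a | 0 < a < 2 * pi /\ rot a (normal L t) = normal L s].

Definition ind_arc L s t : int :=
  homology_class (close_up L s t (short_angle L s t)).

Definition ind_left L v : int := ind_arc L v.1 v.2.
Definition ind_right L v : int := ind_arc L v.2 v.1.

Definition tilde_arc L s t : int :=
  homology_class (close_up L s t (positive_angle L s t)).

Definition tilde_left L v : int := tilde_arc L v.1 v.2.
Definition tilde_right L v : int := tilde_arc L v.2 v.1.

(* At a cusp the derivative of the unit normal is nonzero and orthogonal to it,
   so the sign of this determinant is the direction in which it turns. *)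
Definition turning L t : R := det2 (normal L t) (der 1 (normal L) t).

Definition Cplus L : rat :=
  #|` fset_set [set t | cusps L t /\ 0 < turning L t] |%:R / 2.

Definition Cminus L : rat :=
  #|` fset_set [set t | cusps L t /\ turning L t < 0] |%:R / 2.

End Fronts.

(* Laurent polynomials in q over the rationals are viewed in the field of
   rational functions, where the quotient defining [n]_q makes sense. *)
Definition qfield := {fraction {poly rat}}.

Definition q : qfield := tofrac 'X.

Definition qconst (c : rat) : qfield := tofrac c%:P.

Definition qnum (n : int) : qfield := (q ^ n - q ^ (- n)) / (q - q^-1).

(* Formal rational combinations of the elements f^k of H_1. *)
Definition group_ring := {freeg int / rat}.

Definition fpow (k : int) : group_ring := << k >>.

Definition half_integer (c : rat) : bool := 2 * c \is a Num.int.

Section Invariants.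
Variables (R : realType) (L : legendrian R).

Definition lq : qfield :=
  \sum_(v \in double_points L) qnum (ind_left L v - ind_right L v - eps L v)
  + qconst (Cplus L) * qnum (1 - ind L)
  + qconst (Cminus L) * qnum (ind L + 1)
  + qnum (ind L) * (ind L)%:~R.

Definition Sinv : group_ring :=
  \sum_(v \in double_points L) (fpow (tilde_left L v) - fpow (tilde_right L v))
  + Cplus L *: (fpow 1 - fpow (homology_class (lambda L)))
  + Cminus L *: (fpow (homology_class (lambda L) + 1) - fpow 0).

End Invariants.

Definition qexpansion (x : qfield) (n : {fsfun int -> rat with 0}) : Prop :=
  [/\ x = \sum_(m <- finsupp n) qconst (n m) * qnum m,
      forall m, 0 <= n m /\ half_integer (n m),
      n 0 = 0
    & forall m, 0 < n m -> n (- m) = 0].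

(* Main.v *)
Require Import Defs.
From HB Require Import structures.
From mathcomp Require Import all_boot all_order all_algebra finmap.
From mathcomp Require Import all_classical all_reals all_analysis.
From mathcomp Require Import freeg ring lra zify.

Import Order.TTheory GRing.Theory Num.Theory.
Import numFieldNormedType.Exports.
Local Open Scope ring_scope.

Set Implicit Arguments.
Unset Strict Implicit.
Unset Printing Implicit Defensive.

(** The two invariants determine each other because they correspond term by
    term. Let h be the index of L, and consider the elements S of the group
    ring that are odd under the involution f^l |-> f^(h+1-l). On them,
    f^l |-> [2l-h-1]_q takes f^A - f^B with A + B = h + 1 to 2[A-B]_q, and
    Sinv L is a sum of such binomials. The cusp terms f - f^h and f^(h+1) - 1
    visibly correspond to [1-h]_q and [h+1]_q.

    For a double point v one must see that
      tilde_left + tilde_right = h + 1   and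
      tilde_left - tilde_right = ind_left - ind_right - eps
    ([double_point_indices]). Let alpha in ]0, 2 pi[ be the angle from the normal
    of the second branch to that of the first. The tilde loops are closed by
    alpha on the left and by 2 pi - alpha on the right; these add up to one full
    fiber, whence the sum. The short loops are closed by alpha and - alpha if
    alpha < pi, and by alpha - 2 pi and 2 pi - alpha otherwise, so exactly one
    of the two indices differs from its tilde version, by 1; which one depends
    on the sign of sin alpha, and this sign is eps because each velocity is a
    multiple of the quarter turn of the normal ([eps_sin]). All these classes
    are computed from one continuous angle of the normal
    ([normal_angle_exists], [homology_close_up]).

    Grouping f^l with f^(h+1-l) then turns the relation between the invariants
    into a sum over the positive coefficients of Sinv L, which is at the same
    time the q-expansion sought, with n_(2l-h-1) = max(k_l, 0)
    ([paired_decomposition]). Such an expansion is unique because the differences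
    q^m - q^(-m), m > 0, are linearly independent ([qexpansion_uniq]). *)

(** * Angles and degrees of plane curves *)

Section Angles.
Local Open Scope classical_set_scope.
Local Open Scope ring_scope.
Context {R : realType}.
Implicit Types (a b t x : R) (p : R -> R * R).

(** By the half-angle formula the cosine is 1 only where the sine of the half
    angle vanishes. *)
Lemma cos_eq1 x : - (2 * pi) < x < 2 * pi -> cos x = 1 -> x = 0.
Proof.
move=> /andP[xl xr] cx.
have half (y : R) : 0 < y < 2 * pi -> cos y != 1.
  move=> /andP[y0 y2]; rewrite [y]splitr cosD -!expr2 cos2sin2.
  have : 0 < sin (y / 2) by apply: sin_gt0_pi; apply/andP; split; lra.
  move=> s0; have := mulr_gt0 s0 s0; rewrite -expr2 => s20.
  by apply/eqP; lra.
case: (ltgtP x 0) => // x0.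
- have := half (- x); rewrite cosN cx eqxx; case: (_ < _ < _) / andP => [_ /(_ isT)//|[]].
  by split; lra.
- by have := half x; rewrite cx eqxx x0 xr => /(_ isT).
Qed.

Lemma cos_sub_eq1 a b : unit_vec a = unit_vec b -> cos (a - b) = 1.
Proof. by case=> ca sa; rewrite cosB ca sa -!expr2 cos2Dsin2. Qed.

Lemma unit_vec_inj a b :
  - (2 * pi) < a - b < 2 * pi -> unit_vec a = unit_vec b -> a = b.
Proof.
by move=> ab /cos_sub_eq1 /(cos_eq1 ab) /eqP; rewrite subr_eq0 => /eqP.
Qed.

Lemma unit_vec_period a (k : int) : unit_vec (a + 2 * pi * k%:~R) = unit_vec a.
Proof.
have nat_period n c : unit_vec (c + 2 * pi * n%:R) = unit_vec c :> R * R.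
  have -> : 2 * pi * n%:R = (pi *+ 2) *+ n :> R by rewrite mulr_natr mulr_natl.
  by rewrite /unit_vec (periodicn (@cosD2pi R)) (periodicn (@sinD2pi R)).
case: k => n; first by rewrite -pmulrn nat_period.
by rewrite NegzE mulrNz mulrN -[LHS](nat_period n.+1) -pmulrn subrK.
Qed.

Lemma unit_vec_surj (u : R * R) : dot u u = 1 -> exists a, u = unit_vec a.
Proof.
case: u => c s; rewrite /dot /= => cs.
have c1 : -1 <= c <= 1 by apply/andP; split; nra.
have sa : sin (acos c) = `|s|.
  rewrite sin_acos// -sqrtr_sqr; congr Num.sqrt.
  by rewrite !expr2; lra.
have [s0|s0] := leP 0 s; [exists (acos c)|exists (- acos c)];
  rewrite /unit_vec ?cosN ?sinN acosK// sa.
- by rewrite ger0_norm.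
- by rewrite ltr0_norm// opprK.
Qed.

Lemma rot_unit_vec a b : Defs.rot a (unit_vec b) = unit_vec (a + b).
Proof. by rewrite /Defs.rot /unit_vec /= cosD sinD. Qed.

(** A function with values in 2 pi Z cannot jump. This is the uniqueness of lifts
    of angles up to a constant, applied below to differences of two lifts. *)
Lemma lift_constant a b (g : R -> R) : a <= b ->
  {within `[a, b], continuous g} ->
  (forall x, x \in `[a, b] -> cos (g x) = 1) -> g a = g b.
Proof.
wlog gab : g / g a < g b.
  move=> wl ab gc g1; have [gab|gab|//] := ltgtP (g a) (g b); first exact: wl.
  suff : - g a = - g b by lra.
  apply: (wl (fun x => - g x)) => //; first by rewrite ltrN2.
    by move=> x; apply: continuousN; exact: gc.
  by move=> x xab; rewrite cosN g1.
move=> ab gc g1; have p0 := @pi_gt0 R.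
(* The value g a + d is attained by the intermediate value theorem; d lies
   in ]0, pi], where the cosine is not 1. *)
pose d := Num.min (g b - g a) pi.
have [d0 dpi dab] : [/\ 0 < d, d <= pi & d <= g b - g a].
  by rewrite /d lt_min ge_min ge_min !lexx orbT subr_gt0 gab p0.
have [|c cab gcd] := @IVT R g a b (g a + d) ab gc.
  by rewrite (min_idPl _) ?(max_idPr _) ?(ltW gab)//; apply/andP; split; lra.
have ca : cos (g a) = 1 by apply: g1; rewrite bound_itvE.
have sa : sin (g a) = 0.
  by apply/eqP; rewrite -sqrf_eq0 sin2cos2 ca expr1n subrr.
have := g1 c cab; rewrite gcd cosD ca sa mul1r mul0r subr0.
by move/cos_eq1 => dE; have : d = 0; [apply: dE; apply/andP; split; lra | lra].
Qed.

Lemma angle_mod a : exists k : int, 0 <= a - 2 * pi * k%:~R < 2 * pi.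
Proof.
have p0 : 0 < 2 * pi :> R by rewrite mulr_gt0// pi_gt0.
exists (Num.floor (a / (2 * pi))).
have /andP[] := floor_itv (a / (2 * pi)).
rewrite ler_pdivlMr// ltr_pdivrMr// intrD; lra.
Qed.

Lemma degree_eq p theta (k : int) :
  angle_lift p theta -> theta 1 - theta 0 = 2 * pi * k%:~R -> degree p = k.
Proof.
move=> [tc pt] tk; apply: xget_unique; first by exists theta.
move=> l [eta [ec pe] el].
have : (eta \- theta) 0 = (eta \- theta) 1.
  apply: lift_constant => //.
    by move=> x; apply: continuousB; [exact: ec|exact: tc].
  by move=> x x01; rewrite cos_sub_eq1// -pt// -pe.
move=> /= e; apply/eqP; rewrite -(eqr_int R).
have p0 := @pi_gt0 R; apply/eqP; apply: (@mulfI R (2 * pi)); lra.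
Qed.

Lemma derive0_itv (g : R -> R) a b :
    (forall x, x \in `]a, b[ -> is_derive x 1 g 0) ->
  {in `]a, b[ &, forall x y, g x = g y}.
Proof.
move=> dg x y; wlog xy : x y / x <= y.
  by move=> wl xab yab; case: (leP x y) => [|/ltW] /wl -> //.
rewrite !in_itv /= => /andP[ax xb] /andP[ay yb].
have sub z : z \in `[x, y] -> z \in `]a, b[.
  by rewrite !in_itv /= => /andP[xz zy]; rewrite (lt_le_trans ax)//= (le_lt_trans zy).
have dgxy z : z \in `]x, y[ -> is_derive z 1 g 0.
  by move=> zxy; apply/dg/sub; move: zxy; exact: subset_itv_oo_cc.
have cg : {within `[x, y], continuous g}.
  by apply: derivable_within_continuous => z /sub /dg [].
have [z _] := MVT_segment xy dgxy cg.
by rewrite mul0r => /eqP; rewrite subr_eq0 => /eqP.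
Qed.

(** The angle is the integral of the angular speed w = det(n, n'). Writing (u, v)
    for n turned back by that integral, one finds u' = v' = 0, so n is a
    constant unit vector turned by the integral. The integral starts at a, and
    the fundamental theorem of calculus applies inside ]a, b[. *)
Lemma unit_curve_lift (n : R -> R * R) a b : a < b ->
    smooth n -> (forall t, dot (n t) (n t) = 1) ->
  exists theta : R -> R, forall x, x \in `]a, b[ ->
    {for x, continuous theta} /\ n x = unit_vec (theta x).
Proof.
move=> ab sn n1.
pose c x := (n x).1; pose s x := (n x).2.
have dc x : is_derive x 1 c (derive1 c x).
  have [h _] := sn 0%N x; rewrite derive1E; exact/derivableP.
have ds x : is_derive x 1 s (derive1 s x).
  have [_ h] := sn 0%N x; rewrite derive1E; exact/derivableP.
have cc x : c x * c x + s x * s x = 1 by exact: n1.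
have cds x : c x * derive1 c x + s x * derive1 s x = 0.
  have dr : is_derive x 1 (c * c + s * s) (2 * (c x * derive1 c x + s x * derive1 s x)).
    by apply: is_derive_eq; rewrite /GRing.scale /=; ring.
  have rE : c * c + s * s = cst 1 by apply/funext => y; exact: cc.
  by have := @derive_val _ _ _ _ _ _ _ dr; rewrite rE derive_cst; lra.
pose w x := c x * derive1 s x - s x * derive1 c x.
have wc x : {for x, continuous w}.
  have [hc hs] := sn 1%N x.
  have cont (g : R -> R) : derivable g x 1 -> {for x, continuous g}.
    by move=> /derivable1_diffP /differentiable_continuous.
  apply: continuousB; apply: continuousM.
  - by have [+ _] := sn 0%N x => /cont.
  - exact: cont hs.
  - by have [_ +] := sn 0%N x => /cont.
  - exact: cont hc.
pose F x := (\int[lebesgue_measure]_(t in [set` `[a, x]]) w t)%R.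
have dF x : x \in `]a, b[ -> is_derive x 1 F (w x).
  rewrite in_itv /= => /andP[ax xb].
  have iw : lebesgue_measure.-integrable `[a, b] (EFin \o w).
    apply: continuous_compact_integrable; first exact: segment_compact.
    exact: continuous_subspaceT.
  have [h1 h2] := continuous_FTC1_closed xb iw ax (wc x).
  by rewrite -h2 derive1E; exact/derivableP.
(* The vector n' is orthogonal to n, hence w times the quarter turn of n. *)
have c'E x : derive1 c x = - (s x * w x).
  have -> : - (s x * w x) = derive1 c x * (c x * c x + s x * s x)
      - c x * (c x * derive1 c x + s x * derive1 s x) by rewrite /w; ring.
  by rewrite cc cds mulr1 mulr0 subr0.
have s'E x : derive1 s x = c x * w x.
  have -> : c x * w x = derive1 s x * (c x * c x + s x * s x)
      - s x * (c x * derive1 c x + s x * derive1 s x) by rewrite /w; ring.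
  by rewrite cc cds mulr1 mulr0 subr0.
pose u := c * (cos \o F) + s * (sin \o F).
pose v := s * (cos \o F) - c * (sin \o F).
have du x : x \in `]a, b[ -> is_derive x 1 u 0.
  move=> /dF dFx; apply: is_derive_eq.
  by rewrite /GRing.scale /= c'E s'E; ring.
have dv x : x \in `]a, b[ -> is_derive x 1 v 0.
  move=> /dF dFx; apply: is_derive_eq.
  by rewrite /GRing.scale /= c'E s'E; ring.
pose m := (a + b) / 2.
have mab : m \in `]a, b[ by rewrite in_itv /= /m; apply/andP; split; lra.
have [phi [um vm]] : exists phi, (u m, v m) = unit_vec phi.
  apply: unit_vec_surj; rewrite /dot /=.
  have -> : u m * u m + v m * v m =
      (c m * c m + s m * s m) * (cos (F m) ^+ 2 + sin (F m) ^+ 2).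
    by rewrite /u /v !fctE /=; ring.
  by rewrite cc cos2Dsin2 mulr1.
exists (fun x => phi + F x) => x xab; split.
  apply: continuousD; first exact: cst_continuous.
  apply/differentiable_continuous/derivable1_diffP.
  by have [] := dF x xab.
have ux := derive0_itv du xab mab; have vx := derive0_itv dv xab mab.
rewrite /unit_vec cosD sinD -um -vm -ux -vx [n x]surjective_pairing.
rewrite -[(n x).1]/(c x) -[(n x).2]/(s x).
have -> : u x = c x * cos (F x) + s x * sin (F x) by [].
have -> : v x = s x * cos (F x) - c x * sin (F x) by [].
congr pair; rewrite -[LHS]mulr1 -(cos2Dsin2 (F x)); ring.
Qed.

(** This is what makes the total variation of the angle along a closed curve an
    integral multiple of 2 pi. *)
Lemma unit_vec_eq_mod a b :
  unit_vec a = unit_vec b -> exists k : int, a - b = 2 * pi * k%:~R.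
Proof.
move=> ab; have p0 := @pi_gt0 R.
have [k /andP[k0 k1]] := angle_mod (a - b); exists k.
have := @unit_vec_inj a (b + 2 * pi * k%:~R).
rewrite unit_vec_period => abk; suff : a = b + 2 * pi * k%:~R by lra.
by apply: abk => //; apply/andP; split; lra.
Qed.

Lemma rot_inj (u : R * R) a b : dot u u = 1 ->
  - (2 * pi) < a - b < 2 * pi -> Defs.rot a u = Defs.rot b u -> a = b.
Proof.
move=> /unit_vec_surj [c ->] ab; rewrite !rot_unit_vec => /unit_vec_inj abc.
suff : a + c = b + c by lra.
by apply: abc; have -> : a + c - (b + c) = a - b by ring.
Qed.

Lemma det2_unit_vec a b : det2 (unit_vec a) (unit_vec b) = sin (b - a) :> R.
Proof. by rewrite /det2 /unit_vec /= sinB; ring. Qed.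

End Angles.

(** * Angles at the double points of a front *)

Section Fronts.
Local Open Scope classical_set_scope.
Local Open Scope ring_scope.
Context {R : realType}.
Implicit Types (L : legendrian R) (s t a x : R) (v : R * R) (theta : R -> R).

(** The interval is [0, 2] because an arc from a parameter s in [0, 1[ to a
    smaller parameter t is traversed up to t + 1. *)
Definition normal_angle L theta := forall x, x \in `[0, 2] ->
  {for x, continuous theta} /\ normal L x = unit_vec (theta x).

Lemma normal_angle_exists L : exists theta, normal_angle L theta.
Proof.
have m13 : -1 < 3 :> R by lra.
have [theta lift] := unit_curve_lift m13 (@normal_smooth _ L) (@normal_unit _ L).
exists theta => x; rewrite in_itv /= => /andP[x0 x2]; apply: lift.
by rewrite in_itv /=; apply/andP; split; lra.
Qed.

(** The increment over a period takes values in 2 pi Z, so it does not depend on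
    the starting point; at 0 it computes the index. *)
Lemma normal_angle_shift L theta x : normal_angle L theta -> x \in `[0, 1] ->
  theta (x + 1) = theta x + 2 * pi * (ind L)%:~R.
Proof.
move=> nt x01.
have in02 (y : R) : y \in `[0, 1] -> y \in `[0, 2].
  by rewrite !in_itv /= => /andP[y0 y1]; apply/andP; split; lra.
have in12 (y : R) : y \in `[0, 1] -> y + 1 \in `[0, 2].
  by rewrite !in_itv /= => /andP[y0 y1]; apply/andP; split; lra.
have shift (y : R) : y \in `[0, 1] -> unit_vec (theta (y + 1)) = unit_vec (theta y).
  move=> y01; rewrite -(nt _ (in02 _ y01)).2 -(nt _ (in12 _ y01)).2.
  exact: normal_periodic.
have const : theta (0 + 1) - theta 0 = theta (x + 1) - theta x.
  have x0 : 0 <= x by move: x01; rewrite in_itv /= => /andP[].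
  have sub (y : R) : y \in `[0, x] -> y \in `[0, 1].
    by move: x01; rewrite !in_itv /= => /andP[_ x1] /andP[-> /le_trans ->].
  apply: (@lift_constant _ 0 x (fun y => theta (y + 1) - theta y)) => //.
    apply: continuous_in_subspaceT => y; rewrite inE /= => /sub y01.
    apply: continuousB; last exact: (nt _ (in02 _ y01)).1.
    apply: (@continuous_comp _ _ _ (fun z : R => z + 1) theta).
      by apply: continuousD; [exact: cvg_id|exact: cst_continuous].
    exact: (nt _ (in12 _ y01)).1.
  by move=> y /sub /shift /cos_sub_eq1.
have [k kE] : exists k : int, theta 1 - theta 0 = 2 * pi * k%:~R.
  apply: unit_vec_eq_mod; rewrite -[in theta 1](add0r 1); apply: shift.
  by rewrite bound_itvE.
suff -> : ind L = k by move: const; rewrite add0r; lra.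
apply: degree_eq kE; split; last by move=> y /in02 /nt [].
by apply: continuous_in_subspaceT => y; rewrite inE /= => /in02 /nt [].
Qed.

Lemma arc_end_itv s t : circle s -> circle t -> arc_end s t \in `[0, 2].
Proof.
rewrite /circle /= !in_itv /= => /andP[s0 s1] /andP[t0 t1].
by rewrite /arc_end; case: ifP => _; apply/andP; split; lra.
Qed.

Lemma normal_arc_end L s t : normal L (arc_end s t) = normal L t.
Proof. by rewrite /arc_end; case: ifP => // _; rewrite normal_periodic. Qed.

(** Concatenating the lift of the normal along the arc with the linear angle along
    the fiber lifts the closed curve. *)
Lemma homology_close_up L theta s t a :
    normal_angle L theta -> circle s -> circle t ->
    Defs.rot a (normal L t) = normal L s ->
  2 * pi * (homology_class (close_up L s t a))%:~R
    = theta (arc_end s t) - theta s + a.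
Proof.
move=> nt cs ct rts; set e := arc_end s t.
have /andP[e0 e2] : 0 <= e <= 2 by have := arc_end_itv cs ct; rewrite in_itv.
have /andP[s0 s1] : 0 <= s < 1 by move: cs; rewrite /circle /= in_itv.
have ne : normal L e = unit_vec (theta e) by apply: (nt e _).2; rewrite in_itv /= e0.
have ns : normal L s = unit_vec (theta s).
  by apply: (nt s _).2; rewrite in_itv /= s0; lra.
have [k kE] : exists k : int, theta e + a - theta s = 2 * pi * k%:~R.
  by apply: unit_vec_eq_mod; rewrite -ns -rts -(normal_arc_end L s) -/e ne rot_unit_vec addrC.
(* The minimum freezes the arc and the maximum freezes the fiber on the half
   of [0, 1] where the other one moves. *)
pose arc x := s + Num.min (2 * x) 1 * (e - s).
pose Theta x := theta (arc x) + Num.max (2 * x - 1) 0 * a.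
have arc02 (x : R) : x \in `[0, 1] -> arc x \in `[0, 2].
  rewrite !in_itv /= => /andP[x0 x1].
  have /andP[m0 m1] : 0 <= Num.min (2 * x) 1 <= 1.
    by rewrite le_min ge_min lexx orbT ler01 !andbT; lra.
  by rewrite /arc; apply/andP; split; nra.
suff -> : homology_class (close_up L s t a) = k by rewrite -kE; ring.
apply: (@degree_eq _ _ Theta).
  split.
    apply: continuous_in_subspaceT => x; rewrite inE /= => /arc02 x02.
    have c2 : {for x, continuous (fun y : R => 2 * y)}.
      by apply: continuousM; [exact: cst_continuous|exact: cvg_id].
    have cmin : {for x, continuous (fun y : R => Num.min (2 * y) 1)}.
      exact: (continuous_min c2 (@cst_continuous R R 1 x)).
    have c21 : {for x, continuous (fun y : R => 2 * y - 1)}.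
      exact: (continuousB c2 (@cst_continuous R R 1 x)).
    have cmax : {for x, continuous (fun y : R => Num.max (2 * y - 1) 0)}.
      exact: (continuous_max c21 (@cst_continuous R R 0 x)).
    have carc : {for x, continuous arc}.
      apply: continuousD; first exact: cst_continuous.
      exact: (continuousM cmin (@cst_continuous R R (e - s) x)).
    have ctheta := continuous_comp carc (nt _ x02).1.
    exact: (continuousD ctheta (continuousM cmax (@cst_continuous R R a x))).
  move=> x x01; have [_] := nt _ (arc02 x x01).
  rewrite /Theta /close_up /arc; have [xh|xh] := leP x 2^-1.
    rewrite (min_idPl _) ?(max_idPr _) ?mul0r ?addr0//; lra.
  rewrite (min_idPr _) ?(max_idPl _)/=; [|lra..].
  by rewrite mul1r addrC subrK -/e normal_arc_end => ->; rewrite rot_unit_vec addrC.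
have min1 : Num.min (2 * 1) 1 = 1 :> R by apply/min_idPr; lra.
have min0 : Num.min (2 * 0) 1 = 0 :> R by rewrite mulr0; apply/min_idPl; lra.
have max1 : Num.max (2 * 1 - 1) 0 = 1 :> R by rewrite (max_idPl _); lra.
have max0 : Num.max (2 * 0 - 1) 0 = 0 :> R by apply/max_idPr; lra.
rewrite /Theta /arc min1 min0 max1 max0 !mul0r !mul1r !addr0 -kE.
by rewrite [s + (e - s)]addrC subrK.
Qed.

Lemma short_angleE L s t a :
  - pi < a < pi -> Defs.rot a (normal L t) = normal L s -> short_angle L s t = a.
Proof.
move=> /andP[al ar] ra; apply: xget_unique; first by split; rewrite ?al ?ar.
move=> b [/andP[bl br] rb]; apply: rot_inj (normal_unit L t) _ _.
  by apply/andP; split; lra.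
by rewrite ra rb.
Qed.

Lemma positive_angleE L s t a :
  0 < a < 2 * pi -> Defs.rot a (normal L t) = normal L s ->
  positive_angle L s t = a.
Proof.
move=> /andP[al ar] ra; apply: xget_unique; first by split; rewrite ?al ?ar.
move=> b [/andP[bl br] rb]; apply: rot_inj (normal_unit L t) _ _.
  by apply/andP; split; lra.
by rewrite ra rb.
Qed.

Lemma normal_angle_arcs L theta s t :
    normal_angle L theta -> circle s -> circle t -> s != t ->
  (theta (arc_end s t) - theta s) + (theta (arc_end t s) - theta t)
    = 2 * pi * (ind L)%:~R.
Proof.
move=> nt.
have shift x : circle x -> theta (x + 1) = theta x + 2 * pi * (ind L)%:~R.
  rewrite /circle /= => x01; apply: normal_angle_shift => //.
  by move: x01; exact: subset_itv_co_cc.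
move=> cs ct; rewrite /arc_end neq_lt => /orP[] st.
  by rewrite st ltNge (ltW st) /= shift//; ring.
by rewrite st ltNge (ltW st) /= shift//; ring.
Qed.

(** Each velocity is orthogonal to its normal, hence a multiple of the quarter
    turn of the normal, the multiple being the sign-carrying determinant in
    [positive_branch]. *)
Lemma det2_velocity L s t :
  det2 (velocity L s) (velocity L t) =
  det2 (normal L s) (velocity L s) * det2 (normal L t) (velocity L t)
  * det2 (normal L s) (normal L t).
Proof.
have perp x : velocity L x =
    (- (det2 (normal L x) (velocity L x) * (normal L x).2),
     det2 (normal L x) (velocity L x) * (normal L x).1).
  have := normal_unit L x; have := contact L x; rewrite -/(velocity L x).
  case: (velocity L x) => v1 v2; case: (normal L x) => n1 n2.
  rewrite /dot /det2 /= => nv nn; congr pair.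
    rewrite -[LHS]mulr1 -nn.
    have -> : v1 * (n1 * n1 + n2 * n2) = n1 * (n1 * v1 + n2 * v2)
      - (n1 * v2 - n2 * v1) * n2 by ring.
    by rewrite nv mulr0 sub0r.
  rewrite -[LHS]mulr1 -nn.
  have -> : v2 * (n1 * n1 + n2 * n2) = n2 * (n1 * v1 + n2 * v2)
    + (n1 * v2 - n2 * v1) * n1 by ring.
  by rewrite nv mulr0 add0r.
rewrite {1}[velocity L s]perp {1}[velocity L t]perp.
move: (det2 (normal L s) _) (det2 (normal L t) _) => x y.
by rewrite /det2 /=; ring.
Qed.

(** The ordering of the two branches makes the determinant of the velocities
    positive; by [det2_velocity] the sign of sin a is then the product of the
    signs of the branches. *)
Lemma eps_sin L s t : double_points L (s, t) ->
  forall a, Defs.rot a (normal L t) = normal L s ->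
  (sin a != 0) /\ eps L (s, t) = if 0 < sin a then 1 else -1.
Proof.
move=> [_ _ _] /=; rewrite det2_velocity /eps /positive_branch /= => + a ra.
have -> : det2 (normal L t) (normal L s) = sin a.
  have [c nE] := unit_vec_surj (normal_unit L t).
  by rewrite -ra nE rot_unit_vec det2_unit_vec addrK.
move: (det2 (normal L s) _) (det2 (normal L t) _) (sin a) => x y z.
have [x0|x0|->] := ltgtP x 0; rewrite ?mulr0 ?mul0r ?ltxx//;
  have [y0|y0|->] := ltgtP y 0; rewrite ?mul0r ?ltxx//=.
- by rewrite pmulr_rgt0 ?nmulr_rgt0// => z0; rewrite z0 gt_eqF.
- by rewrite nmulr_rgt0 ?pmulr_rlt0// => z0; rewrite ltNge (ltW z0) lt_eqF.
- by rewrite nmulr_rgt0 ?nmulr_rlt0// => z0; rewrite ltNge (ltW z0) lt_eqF.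
- by rewrite pmulr_rgt0 ?pmulr_rgt0// => z0; rewrite z0 gt_eqF.
Qed.

(** The link between the two kinds of splitting at a double point: closing both
    arcs positively adds one fiber to the index, and compared with the short
    closing it lengthens the right loop if the branches have equal signs
    and the left loop otherwise. *)
Lemma double_point_indices L v : double_points L v ->
  tilde_left L v + tilde_right L v = ind L + 1 /\
  tilde_left L v - tilde_right L v = ind_left L v - ind_right L v - eps L v.
Proof.
case: v => s t dp; have [/= cs ct _ st] := dp; have p0 := @pi_gt0 R.
have sNt : s != t.
  by apply/eqP => se; move: st; rewrite se /det2 mulrC subrr ltxx.
have [theta nt] := normal_angle_exists L.
have n02 x : circle x -> normal L x = unit_vec (theta x).
  rewrite /circle /= in_itv /= => /andP[x0 x1].
  by apply: (nt x _).2; rewrite in_itv /= x0; lra.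
have [k /andP[]] := angle_mod (theta s - theta t).
set a := _ - _ - _ => a0 a2.
have rts : Defs.rot a (normal L t) = normal L s.
  rewrite !n02// rot_unit_vec -(unit_vec_period _ k); congr unit_vec.
  by rewrite /a; ring.
(* Turning back by a, or forward by the complementary angle. *)
have rst b : b = - a \/ b = 2 * pi - a -> Defs.rot b (normal L s) = normal L t.
  rewrite -rts n02// !rot_unit_vec => -[] ->; first by rewrite addKr.
  by rewrite -[RHS](unit_vec_period _ 1); congr unit_vec; ring.
have [sa epsE] := eps_sin dp rts.
have a_gt0 : 0 < a.
  by rewrite lt_def a0 andbT; apply: contraNneq sa => ->; rewrite sin0.
have hA := homology_close_up nt cs ct rts.
have hB := homology_close_up nt ct cs (rst _ (or_intror erefl)).
have hC := homology_close_up nt ct cs (rst _ (or_introl erefl)).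
have hh := normal_angle_arcs nt cs ct sNt.
have tA : positive_angle L s t = a by apply: positive_angleE; rewrite ?a_gt0.
have tB : positive_angle L t s = 2 * pi - a.
  by apply: positive_angleE; [apply/andP; split; lra | exact/rst/or_intror].
have intE (i j : int) : 2 * pi * i%:~R = 2 * pi * j%:~R :> R -> i = j.
  by move=> ij; apply: (@intr_inj R); apply: (@mulfI _ (2 * pi)) => //; rewrite gt_eqF; lra.
rewrite /tilde_left /tilde_right /tilde_arc /= tA tB.
split; first by apply: intE; rewrite !intrD; lra.
rewrite epsE /ind_left /ind_right /ind_arc /=.
have [api|api|api] := ltgtP a pi.
- have -> : short_angle L s t = a by apply: short_angleE => //; apply/andP; split; lra.
  have -> : short_angle L t s = - a.
    by apply: short_angleE; [apply/andP; split; lra | exact/rst/or_introl].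
  rewrite sin_gt0_pi ?a_gt0//; apply: intE; rewrite !(intrD, intrN, mulrNz); lra.
- have r2 : Defs.rot (a - 2 * pi) (normal L t) = normal L s.
    rewrite -rts n02// !rot_unit_vec -(unit_vec_period _ 1).
    by congr unit_vec; ring.
  have hD := homology_close_up nt cs ct r2.
  have -> : short_angle L s t = a - 2 * pi by apply: short_angleE => //; apply/andP; split; lra.
  have -> : short_angle L t s = 2 * pi - a.
    by apply: short_angleE; [apply/andP; split; lra | exact/rst/or_intror].
  have : 0 < sin (a - pi) by apply: sin_gt0_pi; apply/andP; split; lra.
  rewrite sinB cospi sinpi mulr0 subr0 mulrN1 oppr_gt0 => /lt_gtF ->.
  apply: intE; rewrite !(intrD, intrN, mulrNz); lra.
- by move: sa; rewrite api sinpi eqxx.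
Qed.
End Fronts.

(** * Linear independence of quantum numbers *)

Section QuantumNumbers.
Implicit Types (m k l : int) (c : rat).

Lemma q_neq0 : q != 0.
Proof. by rewrite /q tofrac_eq0 polyX_eq0. Qed.

(** The element q is transcendental, in particular not a root of unity. *)
Lemma q_expr_eq1 (n : nat) : q ^+ n = 1 -> n = 0%N.
Proof.
rewrite /q -tofracXn -tofrac1 => /eqP; rewrite tofrac_eq => /eqP Xn.
by have := size_polyXn rat n; rewrite Xn size_poly1 => -[].
Qed.

Lemma q_sub_inv_neq0 : q - q^-1 != 0.
Proof.
rewrite subr_eq0; apply/eqP => qV.
suff /q_expr_eq1 : q ^+ 2 = 1 by [].
by rewrite expr2 {2}qV divff// q_neq0.
Qed.

Lemma qnumN m : qnum (- m) = - qnum m.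
Proof. by rewrite /qnum opprK -mulNr opprB. Qed.

Lemma qnum0 : qnum 0 = 0.
Proof. by rewrite /qnum oppr0 subrr mul0r. Qed.

Lemma qnum_eq0 m : (qnum m == 0) = (m == 0).
Proof.
apply/idP/eqP => [|->]; last by rewrite qnum0.
have pos (n : nat) : qnum n == 0 -> n = 0%N.
  rewrite /qnum mulf_eq0 invr_eq0 (negPf q_sub_inv_neq0) orbF subr_eq0 => /eqP qn.
  have := @q_expr_eq1 (n + n)%N; rewrite exprD {2}[q ^+ n]exprnP qn -exprnN => h.
  suff : (n + n)%N = 0%N by lia.
  by apply: h; rewrite mulfV// expf_neq0// q_neq0.
case: m => n; first by move=> /pos ->.
by rewrite NegzE qnumN oppr_eq0 => /pos.
Qed.

Lemma qconstD c1 c2 : qconst (c1 + c2) = qconst c1 + qconst c2.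
Proof. by rewrite /qconst polyCD tofracD. Qed.
Lemma qconstM c1 c2 : qconst (c1 * c2) = qconst c1 * qconst c2.
Proof. by rewrite /qconst polyCM tofracM. Qed.
Lemma qconstN c : qconst (- c) = - qconst c.
Proof. by rewrite /qconst polyCN tofracN. Qed.
Lemma qconst0 : qconst 0 = 0.
Proof. by rewrite /qconst polyC0 tofrac0. Qed.
Lemma qconst1 : qconst 1 = 1.
Proof. by rewrite /qconst polyC1 tofrac1. Qed.

Lemma int_bound (s : seq int) : exists N : nat, forall m, m \in s -> `|m| <= N%:Z.
Proof.
elim: s => [|a s [N IH]]; first by exists 0%N.
exists (`|a| + N)%N => m; rewrite inE => /orP[/eqP->|/IH]; lia.
Qed.

(** Multiplying a combination of quantum numbers by q^N (q - q^-1), for N at least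
    the absolute value of every index, clears all denominators; see
    [tofrac_cleared]. *)
Definition cleared (n : {fsfun int -> rat with 0}) (N : nat) : {poly rat} :=
  \sum_(m <- finsupp n) n m *: ('X^(`|N%:Z + m|) - 'X^(`|N%:Z - m|)).

Lemma tofrac_cleared (n : {fsfun int -> rat with 0}) (N : nat) :
    (forall m, m \in finsupp n -> `|m| <= N%:Z) ->
  tofrac (cleared n N) =
    q ^+ N * (q - q^-1) * \sum_(m <- finsupp n) qconst (n m) * qnum m.
Proof.
move=> bound; rewrite /cleared rmorph_sum mulr_sumr /= !big_seq.
apply: eq_bigr => m /bound mN; rewrite -mul_polyC tofracM tofracB !tofracXn.
rewrite -/q -/(qconst _) /qnum.
have shift k : `|k| <= N%:Z -> q ^+ `|N%:Z + k| = q ^+ N * q ^ k.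
  move=> kN; rewrite [q ^+ `|_|]exprnP [q ^+ N]exprnP -expfzDr ?q_neq0//.
  by congr (_ ^ _); lia.
have alg (F : fieldType) (a c u w d : F) :
    d != 0 -> c * (a * u - a * w) = a * d * (c * ((u - w) / d)).
  by move=> d0; field.
rewrite (shift m mN) (shift (- m)) ?normrN ?mN//.
exact/alg/q_sub_inv_neq0.
Qed.

(** Coefficients of the cleared polynomial only see the odd part of n, since
    [-m]_q = - [m]_q. *)
Lemma coef_cleared (n : {fsfun int -> rat with 0}) (N : nat) k :
    (forall m, m \in finsupp n -> `|m| <= N%:Z) -> `|k| <= N%:Z ->
  (cleared n N)`_(`|N%:Z + k|) = n k - n (- k).
Proof.
move=> bound kN.
have pick j : n j = \sum_(m <- finsupp n) n m * (m == j)%:R.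
  case: (finsuppP n j) => [jn|jn].
    rewrite big_seq big1// => m mn.
    have [mj|_] := eqVneq m j; last by rewrite mulr0.
    by rewrite -mj mn in jn.
  rewrite (bigD1_seq j) ?fset_uniq//= eqxx mulr1 big1 ?addr0// => m mj.
  by rewrite (negPf mj) mulr0.
rewrite coef_sum (pick k) (pick (- k)) -sumrB !big_seq.
apply: eq_bigr => m /bound mN; rewrite coefZ coefB !coefXn -mulrBr.
congr (_ * (_%:R - _%:R)); congr nat_of_bool; apply/eqP/eqP; lia.
Qed.

(** The value determines n m - n (- m); as both are non-negative and not both
    positive, n m is the positive part of this difference. *)
Lemma qexpansion_uniq x n n' : qexpansion x n -> qexpansion x n' -> n = n'.
Proof.
move=> [xn n_ge0 n0 n_excl] [xn' n'_ge0 n'0 n'_excl]; apply/fsfunP => m.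
have [N bound] := int_bound (m :: finsupp n ++ finsupp n').
have mN : `|m| <= N%:Z by apply: bound; rewrite mem_head.
have bn j : j \in finsupp n -> `|j| <= N%:Z.
  by move=> jn; apply: bound; rewrite inE mem_cat jn orbT.
have bn' j : j \in finsupp n' -> `|j| <= N%:Z.
  by move=> jn; apply: bound; rewrite inE mem_cat jn !orbT.
have diff : n m - n (- m) = n' m - n' (- m).
  rewrite -(coef_cleared bn mN) -(coef_cleared bn' mN).
  suff -> : cleared n N = cleared n' N by [].
  by apply/eqP; rewrite -tofrac_eq !tofrac_cleared// -xn -xn'.
have [nm _] := n_ge0 m; have [nNm _] := n_ge0 (- m).
have [n'm _] := n'_ge0 m; have [n'Nm _] := n'_ge0 (- m).
have := n_excl m; have := n'_excl m; move: nm n'm; rewrite !le_eqVlt.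
move=> /orP[/eqP nm|n_gt0] /orP[/eqP n'm|n'_gt0] e1 e2.
- by rewrite -nm.
- by move: diff; rewrite (e1 n'_gt0); lra.
- by move: diff; rewrite (e2 n_gt0); lra.
- by move: diff; rewrite (e1 n'_gt0) (e2 n_gt0) !subr0.
Qed.

End QuantumNumbers.

(** * Evaluation of the group ring on quantum numbers *)

Section Evaluation.
Implicit Types (S : group_ring) (g : int -> qfield).

(** The linear extension of f^l |-> g l. *)
Definition qeval g S : qfield := \sum_(l <- dom S) qconst (coeff l S) * g l.

Lemma qeval_widen g S (s : seq int) : uniq s -> {subset dom S <= s} ->
  qeval g S = \sum_(l <- s) qconst (coeff l S) * g l.
Proof.
move=> us sub; rewrite [RHS](bigID (mem (dom S))) /= [X in _ + X]big1 ?addr0.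
  rewrite -big_filter; apply: perm_big; apply: uniq_perm.
  - exact: uniq_dom.
  - exact: filter_uniq.
  - by move=> l; rewrite mem_filter andb_idr//; exact: sub.
by move=> l /coeff_outdom ->; rewrite qconst0 mul0r.
Qed.

Lemma qeval0 g : qeval g 0 = 0.
Proof. by rewrite /qeval dom0 big_nil. Qed.

Lemma qevalD g S1 S2 : qeval g (S1 + S2) = qeval g S1 + qeval g S2.
Proof.
pose s := undup (dom S1 ++ dom S2).
rewrite !(@qeval_widen g _ s) ?undup_uniq//.
- by rewrite -big_split; apply: eq_bigr => l _; rewrite coeffD qconstD mulrDl.
- by move=> l; rewrite mem_undup mem_cat => ->; rewrite orbT.
- by move=> l; rewrite mem_undup mem_cat => ->.
- by move=> l /domD_subset; rewrite mem_undup.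
Qed.

Lemma qevalZ g c S : qeval g (c *: S) = qconst c * qeval g S.
Proof.
rewrite (@qeval_widen g (c *: S) (dom S)) ?uniq_dom//; last exact: domZ_subset.
by rewrite /qeval mulr_sumr; apply: eq_bigr => l _; rewrite coeffZ qconstM mulrA.
Qed.

Lemma qeval_fpow g l : qeval g (fpow l) = g l.
Proof. by rewrite /qeval /fpow domU1 big_seq1 coeffU eqxx mulr1 qconst1 mul1r. Qed.

Lemma qevalB g S1 S2 : qeval g (S1 - S2) = qeval g S1 - qeval g S2.
Proof. by rewrite -scaleN1r qevalD qevalZ qconstN qconst1 mulN1r. Qed.

End Evaluation.

(** * Odd elements of the group ring and their q-expansions *)

Section Pairing.
Variable h : int.
Implicit Types (S : group_ring) (x : qfield) (A B l m : int).

(** The correspondence between S and l_q - [h]h that every double point and every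
    cusp respects. The factor 2 appears because f^l and f^(h+1-l) contribute
    equally to the evaluation. *)
Definition paired S x : Prop :=
  [/\ forall l, coeff (h + 1 - l) S = - coeff l S,
      forall l, half_integer (coeff l S)
    & qeval (fun l => qnum (2 * l - h - 1)) S = 2 * x].

Lemma paired0 : paired 0 0.
Proof.
by split=> [l|l|]; rewrite ?coeff0 ?oppr0 ?qeval0 /half_integer ?mulr0 ?rpred0.
Qed.

Lemma pairedD S1 S2 x1 x2 : paired S1 x1 -> paired S2 x2 -> paired (S1 + S2) (x1 + x2).
Proof.
move=> [a1 h1 e1] [a2 h2 e2]; split=> [l|l|].
- by rewrite !coeffD a1 a2 opprD.
- by rewrite /half_integer coeffD mulrDr rpredD//; [exact: h1|exact: h2].
- by rewrite qevalD e1 e2 mulrDr.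
Qed.

Lemma paired_fpow (c : rat) A B : half_integer c -> A + B = h + 1 ->
  paired (c *: (fpow A - fpow B)) (qconst c * qnum (A - B)).
Proof.
move=> ch AB; split=> [l|l|].
- rewrite !coeffZ !coeffB !coeffU !mul1r -mulrN opprB; congr (c * (_%:R - _%:R)).
    by congr nat_of_bool; apply/eqP/eqP; lia.
  by congr nat_of_bool; apply/eqP/eqP; lia.
- rewrite /half_integer coeffZ coeffB !coeffU mulrA rpredM//.
  by rewrite !mul1r rpredB// rpred_nat.
- rewrite qevalZ qevalB !qeval_fpow.
  have -> : 2 * A - h - 1 = A - B by lia.
  have -> : 2 * B - h - 1 = - (A - B) by lia.
  by rewrite qnumN opprK; ring.
Qed.

(** The involution l |-> h + 1 - l exchanges the positive and the negative
    coefficients. *)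
Lemma antisym_sum (V : nmodType) S (F : int -> V) :
    (forall l, coeff (h + 1 - l) S = - coeff l S) ->
  \sum_(l <- dom S) F l = \sum_(l <- dom S | 0 < coeff l S) (F l + F (h + 1 - l)).
Proof.
move=> anti; rewrite big_split /=.
have -> : \sum_(l <- dom S | 0 < coeff l S) F (h + 1 - l) =
          \sum_(l <- dom S | coeff l S < 0) F l.
  transitivity (\sum_(l <- [seq h + 1 - l | l <- dom S] | coeff l S < 0) F l).
    by rewrite [RHS]big_map; apply: eq_bigl => l; rewrite anti oppr_lt0.
  apply: perm_big; apply: uniq_perm; rewrite ?uniq_dom//.
    by rewrite map_inj_uniq ?uniq_dom// => a b; lia.
  move=> l; apply/mapP/idP => [[k kS ->]|lS].
    by move: kS; rewrite !mem_dom anti oppr_eq0.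
  by exists (h + 1 - l); [move: lS; rewrite !mem_dom anti oppr_eq0 | lia].
rewrite (bigID (fun l => 0 < coeff l S)) /=; congr (_ + _).
rewrite big_seq_cond [RHS]big_seq_cond; apply: eq_bigl => l.
by rewrite mem_dom; case: (ltgtP (coeff l S) 0).
Qed.

Lemma paired_positive_part S x : paired S x ->
  x = \sum_(l <- dom S | 0 < coeff l S) qconst (coeff l S) * qnum (2 * l - h - 1).
Proof.
move=> [anti _ ev]; have two : (2 : qfield) != 0.
  have -> : (2 : qfield) = tofrac 2%:P by rewrite -[2%:P]/(polyC (1 + 1)) polyCD tofracD tofrac1.
  by rewrite tofrac_eq0 polyC_eq0.
apply: (mulfI two); rewrite -ev /qeval (antisym_sum _ anti) mulr_sumr.
apply: eq_bigr => l _; rewrite anti qconstN.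
have -> : 2 * (h + 1 - l) - h - 1 = - (2 * l - h - 1) by lia.
by rewrite qnumN; ring.
Qed.

Lemma antisym_decomposition S : (forall l, coeff (h + 1 - l) S = - coeff l S) ->
  S = \sum_(l <- dom S | 0 < coeff l S) coeff l S *: (fpow l - fpow (h + 1 - l)).
Proof.
move=> anti; have E l k : << k *g l >> = k *: fpow l :> group_ring.
  apply/eqP/freeg_eqP => j; rewrite coeffZ !coeffU mul1r//.
rewrite -[LHS]freeg_sumE (antisym_sum _ anti); apply: eq_bigr => l _.
by rewrite !E anti scaleNr scalerBr.
Qed.

(** The candidate for the coefficients n_m: n_(2l-h-1) is the positive part of the
    coefficient k_l. The support is restricted to the m of the form 2l - h - 1,
    so the quotient by 2 is exact where it matters. *)
Definition positive_fsfun S : {fsfun int -> rat with 0} :=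
  [fsfun m in [fset 2 * l - h - 1 | l in dom S]%fset =>
     if 0 < coeff ((h + 1 + m) %/ 2)%Z S then coeff ((h + 1 + m) %/ 2)%Z S else 0].

Lemma positive_fsfunE S l : positive_fsfun S (2 * l - h - 1) =
  if 0 < coeff l S then coeff l S else 0.
Proof.
have half : ((h + 1 + (2 * l - h - 1)) %/ 2)%Z = l by lia.
rewrite fsfunE half; case: ifP => // /imfsetP /= nS.
case: ifP => // l0; case: nS; exists l => //.
by rewrite mem_dom gt_eqF.
Qed.

Lemma positive_fsfun_neq0 S m : positive_fsfun S m != 0 ->
  exists2 l, m = 2 * l - h - 1 & 0 < coeff l S.
Proof.
move=> nz; suff [l ml] : exists l, m = 2 * l - h - 1.
  exists l => //; move: nz; rewrite ml positive_fsfunE.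
  by case: ifP; rewrite ?eqxx.
move: nz; rewrite fsfunE; case: ifP => [/imfsetP[l _ ->] _|]; last by rewrite eqxx.
by exists l.
Qed.

Lemma big_positive_fsfun (V : nmodType) S (F : rat -> int -> V) :
  \sum_(m <- finsupp (positive_fsfun S)) F (positive_fsfun S m) m =
  \sum_(l <- dom S | 0 < coeff l S) F (coeff l S) (2 * l - h - 1).
Proof.
pose s := [seq l <- dom S | 0 < coeff l S]; rewrite -[RHS]big_filter -/s.
transitivity (\sum_(m <- [seq 2 * l - h - 1 | l <- s]) F (positive_fsfun S m) m).
  apply: perm_big; apply: uniq_perm; first exact: fset_uniq.
    by rewrite map_inj_uniq ?filter_uniq ?uniq_dom// => a b; lia.
  move=> m; rewrite mem_finsupp; apply/idP/mapP => [/positive_fsfun_neq0[l -> l0]|[l]].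
    by exists l => //; rewrite mem_filter l0 mem_dom gt_eqF.
  rewrite mem_filter => /andP[l0 _] ->; rewrite positive_fsfunE l0 gt_eqF//.
rewrite [LHS]big_map big_seq [RHS]big_seq; apply: eq_bigr => l.
by rewrite mem_filter positive_fsfunE => /andP[->].
Qed.

Lemma paired_qexpansion S x : paired S x -> qexpansion x (positive_fsfun S).
Proof.
move=> pS; have [anti halfS _] := pS; split.
- by rewrite (paired_positive_part pS) (big_positive_fsfun S (fun c m => qconst c * qnum m)).
- move=> m; have [->|/positive_fsfun_neq0[l -> l0]] := eqVneq (positive_fsfun S m) 0.
    by rewrite lexx /half_integer mulr0 rpred0.
  by rewrite positive_fsfunE l0 ltW.
- apply/eqP/negP => /negP /positive_fsfun_neq0 [l l0 lS].
  (* Here l is fixed by the involution, so its coefficient is its own opposite. *)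
  have : coeff (h + 1 - l) S = coeff l S by congr coeff; lia.
  by rewrite anti; lra.
- move=> m m0; apply/eqP/negP => /negP /positive_fsfun_neq0 [k mk kS].
  have /positive_fsfun_neq0[l ml lS] : positive_fsfun S m != 0 by rewrite gt_eqF.
  have : coeff (h + 1 - l) S = coeff k S by congr coeff; lia.
  by rewrite anti; lra.
Qed.

Lemma paired_decomposition S x : paired S x ->
  exists n : {fsfun int -> rat with 0},
       [/\ unique (qexpansion x) n,
           forall m : int, 0 < n m -> (2 %| h + 1 + m)%Z
         & S = \sum_(m <- finsupp n | 0 < n m)
             n m *: (fpow ((h + 1 + m) %/ 2)%Z - fpow ((h + 1 - m) %/ 2)%Z)].
Proof.
move=> pS; have nP := paired_qexpansion pS; have [anti _ _] := pS.
exists (positive_fsfun S); split.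
- by split=> // n'; exact: qexpansion_uniq.
- move=> m m0; have /positive_fsfun_neq0[l -> _] : positive_fsfun S m != 0 by rewrite gt_eqF.
  lia.
- rewrite {1}(antisym_decomposition anti).
  rewrite [RHS]big_mkcond /= (big_positive_fsfun S (fun c m => if 0 < c then c *:
    (fpow ((h + 1 + m) %/ 2)%Z - fpow ((h + 1 - m) %/ 2)%Z) else 0)).
  apply: eq_bigr => l ->; congr (_ *: (fpow _ - fpow _)); lia.
Qed.

End Pairing.

(** * The two invariants *)

Section Invariants.

(** The summands of both families vanish at the same points, namely where A = B.
    Hence both sums range over one and the same list, and the value 0 given by
    convention to a sum of infinite support is taken by both or by neither. *)
Lemma paired_fsbig (I : choiceType) (h : int) (D : set I) (A B : I -> int) :
    (forall v, D v -> A v + B v = h + 1) ->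
  paired h (\sum_(v \in D) (fpow (A v) - fpow (B v)))
           (\sum_(v \in D) qnum (A v - B v)).
Proof.
move=> AB.
have same_support : finite_support 0 D (fun v => fpow (A v) - fpow (B v)) =
                    finite_support 0 D (fun v => qnum (A v - B v)).
  rewrite /finite_support !unlock; congr (enum_fset (fset_set _)).
  apply/seteqP; split=> v /= [Dv nz]; split=> // /eqP z0; apply: nz.
    by move: z0; rewrite qnum_eq0 subr_eq0 => /eqP ->; rewrite subrr.
  apply/eqP; rewrite qnum_eq0 subr_eq0; move: z0; rewrite subr_eq0 => /eqP.
  move=> /(congr1 (coeff (A v))) /eqP; rewrite !coeffU !mul1r eqxx.
  by rewrite [B v == _]eq_sym; case: (A v == B v).
rewrite same_support big_seq [X in paired _ _ X]big_seq.
apply: (big_ind2 (paired h)); [exact: paired0|by move=> *; exact: pairedD|move=> v vD].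
rewrite -[_ - _]scale1r -[qnum _]mul1r -qconst1; apply: paired_fpow => //.
apply: AB; move: vD; case: finite_supportP => // X XD _ _; exact: XD.
Qed.

Lemma half_integer_half (k : nat) : half_integer (k%:R / 2).
Proof. by rewrite /half_integer mulrC divfK// rpred_nat. Qed.

Lemma paired_invariants (R : realType) (L : legendrian R) :
  paired (ind L) (Sinv L) (lq L - qnum (ind L) * (ind L)%:~R).
Proof.
rewrite /lq addrK /Sinv -[homology_class (lambda L)]/(ind L).
have -> : \sum_(v \in double_points L)
              qnum (ind_left L v - ind_right L v - eps L v) =
          \sum_(v \in double_points L) qnum (tilde_left L v - tilde_right L v).
  by apply: eq_fsbigr => v; rewrite inE => /double_point_indices[_ ->].
apply: pairedD; first apply: pairedD.
- by apply: paired_fsbig => v /double_point_indices[].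
- by apply: paired_fpow; [exact: half_integer_half|rewrite addrC].
- rewrite -[X in qconst _ * qnum X]subr0.
  by apply: paired_fpow; [exact: half_integer_half|rewrite addr0].
Qed.
End Invariants.

Theorem theorem5p3p9 (R : realType) (L : legendrian R) (h : int) :
  generic L -> homology_class (lambda L) = h ->
  lq L = qnum h * h%:~R
         + \sum_(l <- dom (Sinv L) | 0 < coeff l (Sinv L))
             qconst (coeff l (Sinv L)) * qnum (2 * l - h - 1)
  /\ exists n : {fsfun int -> rat with 0},
       [/\ unique (qexpansion (lq L - qnum h * h%:~R)) n,
           forall m : int, 0 < n m -> (2 %| h + 1 + m)%Z
         & Sinv L = \sum_(m <- finsupp n | 0 < n m)
             n m *: (fpow ((h + 1 + m) %/ 2)%Z - fpow ((h + 1 - m) %/ 2)%Z)].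
Proof.
move=> _ <-; have pS := paired_invariants L; split.
  by rewrite -(paired_positive_part pS) addrC subrK.
exact: paired_decomposition pS.
Qed.
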